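(* Let $(X,\mu,T)$ be an ergodic measure-theoretic dynamical system, that is, $X$ is a compact metric space, $T:X\to X$ is a homeomorphism, and $\mu$ is a $T$-invariant ergodic Borel probability measure on $X$. Let $\widetilde{\mu}\in Q(\mu)$ be any measure-theoretic quasifactor of $\mu$. If $(\mathcal{M}(X),\widetilde{\mu},\widetilde{T})$ has $\widetilde{\mu}$-UPE, then $(X,\mu,T)$ has $\mu$-UPE.
   Context: A topological dynamical system (TDS) is a pair $(X,T)$ with $X$ a compact metric space and $T:X\to X$ a homeomorphism. A measure-theoretic dynamical system (MDS) is a triple $(X,\mu,T)$ where $(X,T)$ is a TDS and $\mu$ is a $T$-invariant Borel probability measure on $X$. Space of measures. $\mathcal{M}(X)$ is the space of all Borel probability measures on $X$ with the Prohorov metric $d_P(\mu,\nu)=\inf\{\delta>0:\mu(A)\leq\nu(A^\delta)+\delta\text{ for all Borel }A\subset X\}$, where $A^\delta$ denotes the $\delta$-neighborhood of $A$; this metric induces the weak*-topology and makes $\mathcal{M}(X)$ a compact metric space. The induced homeomorphism $\widetilde{T}:\mathcal{M}(X)\to\mathcal{M}(X)$ is $(\widetilde{T}(\nu))(A)=\nu(T^{-1}(A))$ for Borel $A\subset X$. Quasifactors. A measure-theoretic quasifactor of $(X,\mu,T)$ (or of $\mu$) is a $\widetilde{T}$-invariant Borel probability measure $\widetilde{\mu}$ on $\mathcal{M}(X)$ satisfying the barycenter equation $\mu=\int_{\mathcal{M}(X)}\theta\,d\widetilde{\mu}(\theta)$, meaning that $$\int_X f(x)\,d\mu(x)=\int_{\mathcal{M}(X)}\int_X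 f(x)\,d\theta(x)\,d\widetilde{\mu}(\theta)$$ for every continuous $f:X\to\mathbb{R}$. The set of all measure-theoretic quasifactors of $\mu$ is denoted $Q(\mu)$. Entropy. For an MDS $(Y,\nu,S)$ and a finite measurable partition $\mathcal{P}$ of $Y$, $H_\nu(\mathcal{P})=-\sum_{P\in\mathcal{P}}\nu(P)\log_2\nu(P)$ and $h_\nu(S,\mathcal{P})=\lim_{n\to\infty}\frac1n H_\nu(\mathcal{P}\vee S^{-1}\mathcal{P}\vee\dots\vee S^{-(n-1)}\mathcal{P})$. UPE. For an MDS $(Y,\nu,S)$, a pair of distinct points $y,y'\in Y$ is a $\nu$-entropy pair if $h_\nu(S,\mathcal{P})>0$ for every measurable partition $\mathcal{P}=\{F,F^c\}$ of $Y$ such that $F$ contains a neighborhood of $y$ and $F^c$ contains a neighborhood of $y'$. The MDS $(Y,\nu,S)$ has $\nu$-UPE (measure-theoretic uniformly positive entropy) if every pair of distinct points of $Y$ is a $\nu$-entropy pair; equivalently, if $h_\nu(S,\mathcal{P})>0$ for every two-set Borel partition $\mathcal{P}=\{P_0,P_1\}$ of $Y$ with $\operatorname{int}P_0\neq\varnothing$ and $\operatorname{int}P_1\neq\varnothing$ (a replete partition). *)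

(* Defs.v *)
From HB Require Import structures.
From mathcomp Require Import all_boot all_order all_algebra.
From mathcomp Require Import lra.
From mathcomp Require Import all_classical all_reals all_analysis.

Set Implicit Arguments.
Unset Strict Implicit.
Unset Printing Implicit Defensive.

Import Order.TTheory GRing.Theory Num.Theory.
Import numFieldNormedType.Exports.

Local Open Scope classical_set_scope.
Local Open Scope ring_scope.

(* Measurable types are pointed in the library. Requiring a point loses no
   generality here: a space carrying a probability measure is nonempty. *)
#[short(type="pmetricType")]
HB.structure Definition PointedMetric (R : numDomainType) :=
  {M of Pointed M & Metric R M}.

Definition borel (X : ptopologicalType) : measurableType (@open X).-sigma :=
  g_sigma_algebraType (@open X).

Structure homeo (X Y : topologicalType) := Homeo {
  homeo_fun :> X -> Y;
  homeo_continuous : continuous homeo_fun;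
  homeo_inverse : exists g : Y -> X,
    [/\ cancel homeo_fun g, cancel g homeo_fun & continuous g] }.

Lemma continuous_borel (X Y : ptopologicalType) (f : X -> Y) :
  continuous f -> measurable_fun [set: borel X] (f : borel X -> borel Y).
Proof.
move=> /continuousP cf; apply: (@measurability _ _ (borel X) (borel Y) _ _ (@open Y)) => //.
move=> _ [B oB <-].
by rewrite setTI; apply: sub_sigma_algebra; exact: cf.
Qed.

(* The library's measures are functions on all subsets, constrained only on
   measurable ones. Asking for the value 0 elsewhere makes Leibniz equality on
   [pmeas X] the equality of Borel measures. *)
Structure pmeas (R : realType) (X : ptopologicalType) := PMeas {
  pmeas_prob :> probability (borel X) R;
  pmeas_out : forall A : set (borel X),
    ~ measurable A -> pmeas_prob A = 0%E }.

Definition borel_restr (R : realType) (X : ptopologicalType)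
    (m : set (borel X) -> \bar R) (A : set (borel X)) : \bar R :=
  if `[< measurable A >] then m A else 0%E.

Section borel_restr_probability.
Context (R : realType) (X : ptopologicalType) (P : probability (borel X) R).

Let restrE A : measurable A -> borel_restr P A = P A.
Proof. by move=> mA; rewrite /borel_restr asboolT. Qed.

Let restr0 : borel_restr P set0 = 0%E.
Proof. by rewrite restrE// measure0. Qed.

Let restr_ge0 A : (0 <= borel_restr P A)%E.
Proof. by rewrite /borel_restr; case: ifP. Qed.

Let restr_sigma_additive : semi_sigma_additive (borel_restr P).
Proof.
move=> F mF tF mUF; rewrite restrE//.
under eq_fun do under eq_bigr do rewrite restrE//.
exact: measure_semi_sigma_additive.
Qed.

HB.instance Definition _ := isMeasure.Build _ _ _ (borel_restr P)
  restr0 restr_ge0 restr_sigma_additive.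

Let restr_setT : borel_restr P [set: borel X] = 1%E.
Proof. by rewrite restrE// probability_setT. Qed.

HB.instance Definition _ :=
  Measure_isProbability.Build _ _ _ (borel_restr P) restr_setT.

Let restr_out (A : set (borel X)) : ~ measurable A -> borel_restr P A = 0%E.
Proof. by move=> mA; rewrite /borel_restr asboolF. Qed.

Definition mk_pmeas : pmeas R X := PMeas (pmeas_prob := borel_restr P) restr_out.

Lemma mk_pmeasE (A : set (borel X)) : measurable A -> mk_pmeas A = P A.
Proof. exact: restrE. Qed.

End borel_restr_probability.

HB.instance Definition _ (R : realType) (X : ptopologicalType) :=
  gen_eqMixin (pmeas R X).
HB.instance Definition _ (R : realType) (X : ptopologicalType) :=
  gen_choiceMixin (pmeas R X).
HB.instance Definition _ (R : realType) (X : ptopologicalType) :=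
  isPointed.Build (pmeas R X) (mk_pmeas point).

Lemma pmeas_ext (R : realType) (X : ptopologicalType) (m n : pmeas R X) :
  (forall A : set (borel X), measurable A -> m A = n A) -> m = n.
Proof.
move: m n => [m m0] [n n0] /= mn.
have fE : m = n :> (set (borel X) -> \bar R).
  apply/funext => A; have [mA|mA] := pselect (measurable A); first exact: mn.
  by rewrite m0// n0.
suff mE : m = n by subst n; congr PMeas; exact: Prop_irrelevance.
clear -fE; move: m n fE => [m cm] [n cn] /= fE; subst n; congr Probability.Pack.
move: cm cn => [[a1 a2] [a3] [a4] [a5] [a6] [a7] [a8]].
move=> [[b1 b2] [b3] [b4] [b5] [b6] [b7] [b8]].
by rewrite (Prop_irrelevance a1 b1) (Prop_irrelevance a2 b2)
  (Prop_irrelevance a3 b3) (Prop_irrelevance a4 b4) (Prop_irrelevance a5 b5)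
  (Prop_irrelevance a6 b6) (Prop_irrelevance a7 b7) (Prop_irrelevance a8 b8).
Qed.

Definition nbhd_of (R : realType) (X : pmetricType R) (A : set X) (d : R) :
  set X := \bigcup_(a in A) ball a d.

Definition prohorov_le (R : realType) (X : pmetricType R) (m n : pmeas R X)
    (d : R) :=
  forall A : set (borel X), measurable A -> (m A <= n (nbhd_of A d) + d%:E)%E.

Definition prohorov_dist (R : realType) (X : pmetricType R) (m n : pmeas R X) : R :=
  inf [set d | 0 < d /\ prohorov_le m n d].

Section prohorov_metric.
Context (R : realType) (X : pmetricType R).
Implicit Types (A : set X) (d e : R) (m n p : pmeas R X).

Let in_nbhd A d x : nbhd_of A d x <-> exists2 a, A a & mdist a x < d.
Proof.
by split=> -[a Aa]; [rewrite ballEmdist/=; exists a|exists a => //; rewrite ballEmdist].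
Qed.

Let sub_nbhd A d : 0 < d -> A `<=` nbhd_of A d.
Proof. by move=> d0 x Ax; apply/in_nbhd; exists x => //; rewrite mdistxx. Qed.

Let nbhd_le A d e : d <= e -> nbhd_of A d `<=` nbhd_of A e.
Proof.
move=> de x /in_nbhd[a Aa ad]; apply/in_nbhd; exists a => //.
exact: lt_le_trans ad de.
Qed.

Let open_nbhd A d : open (nbhd_of A d).
Proof.
apply: bigcup_open => a _; rewrite openE => x; rewrite ballEmdist/= => axd.
apply/nbhs_ballP; exists (d - mdist a x) => /=; first by rewrite subr_gt0.
move=> y; rewrite !ballEmdist/= => xy.
by rewrite (le_lt_trans (metric_triangle a x y))// addrC -ltrBrDr.
Qed.

Let m_open A : open A -> measurable (A : set (borel X)).
Proof. exact: sub_sigma_algebra. Qed.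

Let m_nbhd A d : measurable (nbhd_of A d : set (borel X)).
Proof. by apply: m_open; exact: open_nbhd. Qed.

Let le_prob m (A B : set (borel X)) : measurable A -> measurable B ->
  A `<=` B -> (m A <= m B)%E.
Proof. by move=> mA mB AB; apply: le_measure; rewrite ?inE. Qed.

Let prohorov_le_mono m n d e : d <= e -> prohorov_le m n d -> prohorov_le m n e.
Proof.
move=> de mn A mA; apply: (le_trans (mn A mA)); apply: leeD; last by rewrite lee_fin.
by apply: le_prob => //; exact: nbhd_le.
Qed.

Let prohorov_le1 m n : prohorov_le m n 1.
Proof.
move=> A mA; apply: (le_trans (probability_le1 _ mA)).
by rewrite leeDr.
Qed.

Let dist_le m n e : 0 < e -> prohorov_le m n e -> prohorov_dist m n <= e.
Proof. by move=> e0 mn; apply: ge_inf => //; exists 0 => x [/ltW]. Qed.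

Let dist_ltP m n e : prohorov_dist m n < e -> 0 < e /\ prohorov_le m n e.
Proof.
move=> /inf_lt[]; first by exists 1; split.
move=> d [d0 mn] de; split; first exact: lt_trans de.
exact: prohorov_le_mono (ltW de) mn.
Qed.

Let dist_ge0 m n : 0 <= prohorov_dist m n.
Proof. by apply: lb_le_inf; [exists 1; split|move=> x [/ltW]]. Qed.

Let le_dist m n e : (forall d, e < d -> 0 < d /\ prohorov_le m n d) ->
  prohorov_dist m n <= e.
Proof.
move=> h; apply/ler_addgt0Pr => d d0.
by apply: dist_le; apply h; rewrite ltrDl.
Qed.

Let dist_refl m : prohorov_dist m m = 0.
Proof.
apply/eqP; rewrite eq_le dist_ge0 andbT; apply: le_dist => d d0; split => //.
move=> A mA; apply: (@le_trans _ _ (m (nbhd_of A d))).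
  by apply: le_prob => //; exact: sub_nbhd.
by rewrite leeDl// lee_fin ltW.
Qed.

Let prohorov_le_sym m n d : prohorov_le m n d -> prohorov_le n m d.
Proof.
move=> mn A mA; set B := ~` (nbhd_of A d).
have mB : measurable (B : set (borel X)) by exact: measurableC.
have BA : nbhd_of B d `<=` ~` A.
  move=> x /in_nbhd[b Bb bx] Ax; apply: Bb; apply/in_nbhd.
  by exists x => //; rewrite metric_sym.
have : (m B <= n (~` A) + d%:E)%E.
  apply: (le_trans (mn B mB)); apply: leeD => //.
  by apply: le_prob => //; exact: measurableC.
rewrite /B !probability_setC//.
rewrite -(fineK (fin_num_measure m _ (m_nbhd A d))).
rewrite -(fineK (fin_num_measure n _ mA)).
rewrite -!EFinB -!EFinD !lee_fin; lra.
Qed.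

Let dist_sym m n : prohorov_dist m n = prohorov_dist n m.
Proof.
by apply/eqP; rewrite eq_le; apply/andP; split; apply: le_dist => d
  /dist_ltP[d0 h]; split => //; exact: prohorov_le_sym.
Qed.

Let dist_triangle n m p :
  prohorov_dist m p <= prohorov_dist m n + prohorov_dist n p.
Proof.
apply/ler_addgt0Pr => e e0.
have e2 : 0 < e / 2 by rewrite divr_gt0.
have [d0 mn] : 0 < prohorov_dist m n + e / 2 /\
  prohorov_le m n (prohorov_dist m n + e / 2) by apply: dist_ltP; rewrite ltrDl.
have [d0' np] : 0 < prohorov_dist n p + e / 2 /\
  prohorov_le n p (prohorov_dist n p + e / 2) by apply: dist_ltP; rewrite ltrDl.
rewrite [e]splitr addrACA; apply: dist_le; first exact: addr_gt0.
move=> A mA; apply: (le_trans (mn A mA)).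
apply: (le_trans (leeD (np _ (m_nbhd _ _)) (lexx _))).
rewrite -addeA -EFinD; apply: leeD; last by rewrite lee_fin addrC.
apply: le_prob => // x /in_nbhd[y /in_nbhd[a Aa ay] yx].
apply/in_nbhd; exists a => //.
by rewrite (le_lt_trans (metric_triangle a y x))// ltrD.
Qed.

Let closed_nbhdI (F : set X) : closed F ->
  \bigcap_k nbhd_of F (k.+1%:R^-1) = F.
Proof.
move=> cF; apply/seteqP; split; last by move=> x Fx k _; exact: sub_nbhd.
move=> x h; apply: cF => B /nbhs_ballP[e /= e0 eB].
have [k ke] : exists k : nat, k.+1%:R^-1 < e.
  by have [k _ /(_ k (leqnn k))] := near_infty_natSinv_lt (PosNum e0); exists k.
have /in_nbhd[a Fa ax] := h k I.
exists a; split => //; apply: eB; rewrite ballEmdist/= metric_sym.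
exact: lt_trans ax ke.
Qed.

Let le_closed m n (F : set X) : (forall d, 0 < d -> prohorov_le m n d) ->
  closed F -> (m F <= n F)%E.
Proof.
move=> mn cF.
have mF : measurable (F : set (borel X)).
  rewrite -[F]setCK; apply: measurableC; apply: m_open.
  by rewrite openC.
pose G k := nbhd_of F (k.+1%:R^-1) : set (borel X).
have cG : n (G k) @[k --> \oo] --> n F.
  rewrite -[X in _ --> n X](closed_nbhdI cF).
  apply: (@nonincreasing_cvg_mu _ _ _ n G).
  - exact: le_lt_trans (probability_le1 n (m_nbhd _ _)) (ltry _).
  - by move=> k; exact: m_nbhd.
  - by rewrite /G closed_nbhdI.
  - move=> i j ij; apply/subsetPset/nbhd_le.
    by rewrite lef_pV2 ?posrE// ler_nat ltnS.
have cGD : (n (G k) + k.+1%:R^-1%:E)%E @[k --> \oo] --> (n F + 0)%E.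
  apply: cvgeD => //; first by rewrite fin_num_adde_defl.
  exact: (@cvge_harmonic R).
rewrite -[leRHS]adde0 -(cvg_lim _ cGD)//.
apply: lime_ge; first by apply/cvg_ex; exists (n F + 0)%E.
by apply: nearW => k; apply: mn.
Qed.

Let dist_pos m n : prohorov_dist m n = 0 -> m = n.
Proof.
move=> mn0.
have mn d : 0 < d -> prohorov_le m n d.
  by move=> d0; have [] := @dist_ltP m n d; rewrite ?mn0.
have nm d : 0 < d -> prohorov_le n m d by move=> /mn; exact: prohorov_le_sym.
have mnF F : closed F -> m F = n F.
  by move=> cF; apply/eqP; rewrite eq_le !le_closed.
apply: pmeas_ext => A mA.
apply: (@measure_unique _ R (borel X) (@open X) (fun=> setT)) => //.
- by move=> B C; exact: openI.
- by move=> _; exact: openT.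
- by rewrite bigcup_const//; exists 0%N.
- move=> B oB.
  have mCB : measurable (~` B : set (borel X)).
    by apply: measurableC; exact: m_open.
  suff : m (~` ~` B) = n (~` ~` B) by rewrite setCK.
  rewrite (probability_setC m mCB) (probability_setC n mCB) mnF//.
  exact: open_closedC.
- by move=> _; rewrite [X in (X < _)%E](probability_setT m) ltry.
Qed.

HB.instance Definition _ := isMetric.Build R (pmeas R X)
  dist_refl dist_pos dist_sym dist_triangle.

End prohorov_metric.

Definition invariant_measure (R : realType) d (Y : measurableType d)
    (nu : probability Y R) (S : Y -> Y) :=
  forall A : set Y, measurable A -> nu (S @^-1` A) = nu A.

Definition ergodic (R : realType) d (Y : measurableType d)
    (nu : probability Y R) (S : Y -> Y) :=
  forall A : set Y, measurable A -> S @^-1` A = A ->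
    nu A = 0%E \/ nu A = 1%E.

Section induced_map.
Context (R : realType) (X : ptopologicalType) (T : homeo X X).

Let mT : isMeasurableFun _ _ (borel X) (borel X) T.
Proof. by split; apply: continuous_borel; exact: homeo_continuous. Qed.

Definition homeo_mfun : {mfun borel X >-> borel X} :=
  HB.pack (T : borel X -> borel X) mT.

Definition induced_map (nu : pmeas R X) : pmeas R X :=
  mk_pmeas (distribution nu homeo_mfun).

Lemma induced_mapE (nu : pmeas R X) (A : set (borel X)) :
  measurable A -> induced_map nu A = nu (T @^-1` A).
Proof. by move=> mA; rewrite mk_pmeasE. Qed.

End induced_map.

Definition quasifactor (R : realType) (X : pmetricType R) (T : homeo X X)
    (mu : probability (borel X) R) (mut : probability (borel (pmeas R X)) R) :=
  invariant_measure mut (induced_map T) /\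
  forall f : X -> R, continuous f ->
    (\int[mu]_x (f x)%:E = \int[mut]_theta \int[theta : pmeas R X]_x (f x)%:E)%E.

Definition log2 (R : realType) (x : R) : R := ln x / ln 2.

(* A finite partition is given as the family of its cells, indexed by a finite
   type; some of the cells may be empty, which contribute 0 (here ln 0 = 0). *)
Definition partition_entropy (R : realType) d (Y : measurableType d)
    (nu : probability Y R) (I : finType) (P : I -> set Y) : R :=
  - \sum_(i : I) fine (nu (P i)) * log2 (fine (nu (P i))).

(* The cells of the join of P, S^-1 P, ..., S^-(n-1) P, indexed by itineraries. *)
Definition refinement (Y : Type) (S : Y -> Y) (I : finType) (P : I -> set Y)
    (n : nat) (w : {ffun 'I_n -> I}) : set Y :=
  [set y | forall k : 'I_n, P (w k) (iter k S y)].

Definition ks_entropy (R : realType) d (Y : measurableType d)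
    (nu : probability Y R) (S : Y -> Y) (I : finType) (P : I -> set Y) : R :=
  limn (fun n => n%:R^-1 * partition_entropy nu (refinement S P (n := n))).

Definition bipartition (Y : Type) (F : set Y) (b : bool) : set Y :=
  if b then F else ~` F.

Definition entropy_pair (R : realType) (Y : pmetricType R)
    (nu : probability (borel Y) R) (S : Y -> Y) (y y' : Y) :=
  y <> y' /\
  forall F : set (borel Y), measurable F ->
    nbhs y (F : set Y) -> nbhs y' (~` F : set Y) ->
    0 < ks_entropy nu S (bipartition F).

Definition UPE (R : realType) (Y : pmetricType R)
    (nu : probability (borel Y) R) (S : Y -> Y) :=
  forall y y' : Y, y <> y' -> entropy_pair nu S y y'.

(* Main.v *)
Require Import Defs.
From HB Require Import structures.
From mathcomp Require Import all_boot all_order all_algebra.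
From mathcomp Require Import ring lra.
From mathcomp Require Import all_classical all_reals all_analysis.
From mathcomp Require Import measurable_realfun.

Set Implicit Arguments.
Unset Strict Implicit.
Unset Printing Implicit Defensive.

Import Order.TTheory GRing.Theory Num.Theory.
Import numFieldNormedType.Exports.

Local Open Scope classical_set_scope.
Local Open Scope ring_scope.

(** The map [theta |-> theta F] is the conditional expectation of the indicator
    of [F] in the joining of the quasifactor with [mu] that attaches to [theta]
    a random point of law [theta]. If the process of visits to [F] has zero
    entropy, then it is independent of the quasifactor relative to the Pinsker
    factor of the latter, so that [theta |-> theta F] is measurable for that
    Pinsker factor and every set [{theta | c < theta F}] has zero entropy. The
    proof below makes this quantitative and elementary.

    Attach to [theta] a family of [m] independent points of law [theta], and let
    each of them move along its orbit. At time [i] the proportion of these points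
    that lie in [F] is close to the mass of [F] for the [i]-th image of [theta]
    (Chebyshev), so it tells on which side of [c] this mass lies, except with
    small probability or when the mass lies in a narrow band above [c]; by
    invariance the latter has small probability too. With [e] a bound for the
    total error, the word of length [n] read from the orbit of [theta] is
    described, up to [n] noisy bits, by the [m] words of length [n] of the
    points. Each of these has the law given by [mu], since [mu] is the
    barycenter of the quasifactor. Gibbs' inequality turns this description into
      [H~(n) <= m * H(n) + n * (- ln (1 - e) - e * ln e)]
    ([quasifactor_word_entropy_le]), where [H~] and [H] are the entropies of the
    words of length [n] for [{theta | c < theta F}] and for [F]. Dividing by [n]
    and choosing first [e], then the band, then [m], one sees that positive
    entropy in the space of measures forces positive entropy of [F]
    ([quasifactor_entropy_gt0]).

    If now [F] contains a neighborhood of [y] and its complement one of [y'],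
    then [{theta | 1/2 < theta F}] contains a neighborhood of the point mass at
    [y] and its complement contains one of the point mass at [y'], so that it
    has positive entropy by hypothesis.

    Two points need care. The entropy is defined as a total limit, whose value
    is 0 when the sequence diverges; for [F] convergence follows from
    subadditivity, and in the space of measures from the positivity of the
    value. Also, the sigma-algebra on that space is generated by the open sets
    of the Prohorov metric: evaluations are measurable for it because evaluation
    at an open set is lower semicontinuous. *)

(** * Entropy of finite distributions *)

(** Shannon entropy, in nats, of a weight function on a finite type; points of
    weight 0 contribute 0 since ln 0 = 0. *)
Definition entropy (R : realType) (W : finType) (p : W -> R) : R :=
  - \sum_w p w * ln (p w).

Section finite_entropy.
Context {R : realType}.

Lemma gibbs_term (a b : R) : 0 <= a -> 0 <= b -> (b = 0 -> a = 0) ->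
  a * - ln a <= a * - ln b + (b - a).
Proof.
move=> a0 b0 ba.
have [->|aN0] := eqVneq a 0; first by rewrite !mul0r add0r subr0.
have apos : 0 < a by rewrite lt_neqAle eq_sym aN0.
have bpos : 0 < b.
  by rewrite lt_neqAle b0 andbT eq_sym; apply: contra_neq aN0.
have h : ln (b / a) <= b / a - 1.
  rewrite -[X in ln X](subrKC 1); apply: le_ln1Dx.
  by rewrite ltrBrDl subrr divr_gt0.
have {h} := ler_wpM2l a0 h.
rewrite ln_div ?posrE// mulrBr mulrBr mulr1 mulrCA divff// mulr1; lra.
Qed.

(** Gibbs' inequality: describing [p] with a code fitted to a weight [r] of no
    larger total mass costs at least the entropy of [p]. *)
Lemma gibbs (W : finType) (p r : W -> R) :
  (forall w, 0 <= p w) -> (forall w, 0 <= r w) ->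
  (forall w, r w = 0 -> p w = 0) -> \sum_w r w <= \sum_w p w ->
  entropy p <= \sum_w p w * - ln (r w).
Proof.
move=> p0 r0 rp le_rp; rewrite /entropy -sumrN.
apply: (@le_trans _ _ (\sum_w (p w * - ln (r w) + (r w - p w)))).
  by apply: ler_sum => w _; rewrite -mulrN gibbs_term// => /rp.
by rewrite big_split/= sumrB gerDl subr_le0.
Qed.

(** Entropy does not increase under taking marginals, so the entropy of the
    marginal is bounded by the cost of describing the pair in any model [r]. *)
Lemma entropy_marginal_le (W V : finType) (p r : W -> V -> R) :
  (forall w v, 0 <= p w v) -> (forall w v, 0 <= r w v) ->
  (forall w v, r w v = 0 -> p w v = 0) ->
  \sum_w \sum_v r w v <= \sum_w \sum_v p w v ->
  entropy (fun w => \sum_v p w v) <= \sum_w \sum_v p w v * - ln (r w v).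
Proof.
move=> p0 r0 rp le_rp.
apply: (@le_trans _ _ (entropy (fun k : W * V => p k.1 k.2))); last first.
  rewrite pair_big/=; apply: (@gibbs _ _ (fun k => r k.1 k.2)) => //.
  - by case=> w v; exact: rp.
  - by rewrite !pair_big/= in le_rp.
rewrite /entropy lerN2 -(pair_big xpredT xpredT (fun w v => p w v * ln (p w v)))/=.
apply: ler_sum => w _; rewrite mulr_suml; apply: ler_sum => v _.
have [->|pN0] := eqVneq (p w v) 0; first by rewrite !mul0r.
rewrite ler_wpM2l//; have ppos : 0 < p w v by rewrite lt_neqAle eq_sym pN0 p0.
have le_p : p w v <= \sum_v0 p w v0.
  by rewrite (bigD1 v)//= lerDl sumr_ge0.
by rewrite ler_ln ?posrE//; exact: lt_le_trans le_p.
Qed.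

Lemma sum_fibers (W U : finType) (f : W -> U) (p : W -> R) (F : U -> R) :
  \sum_u (\sum_(w | f w == u) p w) * F u = \sum_w p w * F (f w).
Proof.
rewrite [RHS](partition_big f xpredT)//=; apply: eq_bigr => u _.
by rewrite mulr_suml; apply: eq_bigr => w /eqP ->.
Qed.

(** A variable determined by the pair of its images under [f] and [g] has at
    most the sum of their entropies. *)
Lemma entropy_pair_le (W U V : finType) (f : W -> U) (g : W -> V)
    (p : W -> R) :
  injective (fun w => (f w, g w)) ->
  (forall w, 0 <= p w) -> \sum_w p w = 1 ->
  entropy p <= entropy (fun u => \sum_(w | f w == u) p w) +
               entropy (fun v => \sum_(w | g w == v) p w).
Proof.
move=> fg_inj p0 p1.
set pf := fun u => \sum_(w | f w == u) p w.
set pg := fun u => \sum_(w | g w == u) p w.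
have pf0 u : 0 <= pf u by exact: sumr_ge0.
have pg0 u : 0 <= pg u by exact: sumr_ge0.
have pfle w : p w <= pf (f w) by rewrite /pf (bigD1 w)//= lerDl sumr_ge0.
have pgle w : p w <= pg (g w) by rewrite /pg (bigD1 w)//= lerDl sumr_ge0.
have pf1 : \sum_u pf u = 1.
  by rewrite -p1 [RHS](partition_big f xpredT).
have pg1 : \sum_u pg u = 1.
  by rewrite -p1 [RHS](partition_big g xpredT).
(* The model: the two images are independent. *)
apply: (le_trans (@gibbs _ p (fun w => pf (f w) * pg (g w)) _ _ _ _)) => //.
- by move=> w; rewrite mulr_ge0.
- move=> w /eqP; rewrite mulf_eq0 => /orP[] /eqP h; apply/eqP;
    by rewrite eq_le p0 andbT -h.
- rewrite p1; apply: (@le_trans _ _ (\sum_(k : U * V) pf k.1 * pg k.2)).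
    rewrite -(big_imset (fun k : U * V => pf k.1 * pg k.2)
      (h := fun w => (f w, g w)) (A := predT))/=; last first.
      by move=> w w' _ _; exact: fg_inj.
    rewrite [leRHS](bigID (mem [set (f w, g w) | w in W]%SET))/= lerDl.
    by apply: sumr_ge0 => k _; rewrite mulr_ge0.
  rewrite -(pair_big xpredT xpredT (fun u v => pf u * pg v))/=.
  by under eq_bigr do rewrite -mulr_sumr pg1 mulr1; rewrite pf1.
rewrite /entropy -!sumrN.
under [X in _ <= X + _]eq_bigr do rewrite -mulrN.
under [X in _ <= _ + X]eq_bigr do rewrite -mulrN.
rewrite !sum_fibers -big_split/=; apply: ler_sum => w _.
rewrite -mulrDr; have [->|pN0] := eqVneq (p w) 0; first by rewrite !mul0r.
have ppos : 0 < p w by rewrite lt_neqAle eq_sym pN0 p0.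
by rewrite lnM ?posrE ?opprD//;
  [exact: lt_le_trans (pfle w)|exact: lt_le_trans (pgle w)].
Qed.

Lemma entropy_ge0 (W : finType) (p : W -> R) :
  (forall w, 0 <= p w <= 1) -> 0 <= entropy p.
Proof.
move=> p01; rewrite /entropy -sumrN; apply: sumr_ge0 => w _.
have /andP[p0 p1] := p01 w; by rewrite -mulrN mulr_ge0// oppr_ge0 ln_le0.
Qed.

(** Correcting a bit that is wrong with probability at most [e] costs at most
    [- ln (1 - e) - e * ln e], which is arbitrarily small. *)
Lemma small_bit_cost (h : R) : 0 < h ->
  exists2 e : R, 0 < e < 1 & - ln (1 - e) - e * ln e < h.
Proof.
(* With [e = s ^ 2] the cost is at most [4 * s]. *)
move=> h0; pose s := Num.min (1/2) (h / 8).
have s0 : 0 < s by rewrite lt_min divr_gt0//= divr_gt0.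
have s12 : s <= 1/2 by rewrite ge_min lexx.
have s8 : s <= h / 8 by rewrite ge_min lexx orbT.
have ss : 0 < s * s by rewrite mulr_gt0.
have ss12 : s * s <= s / 2 by nra.
exists (s * s); first by apply/andP; split; nra.
have e1 : 0 < 1 - s * s by nra.
have l1 : - ln (1 - s * s) <= 2 * (s * s).
  rewrite -lnV ?posrE//.
  have -> : (1 - s * s)^-1 = 1 + s * s / (1 - s * s).
    by field; rewrite gt_eqF.
  apply: (@le_trans _ _ (s * s / (1 - s * s))).
    by apply: le_ln1Dx; apply: (@lt_trans _ _ 0); [lra|rewrite divr_gt0].
  by rewrite ler_pdivrMr//; nra.
have l2 : - ln s <= s^-1.
  rewrite -lnV ?posrE//; apply/ltW/ln_sublinear; by rewrite invr_gt0.
have l3 : - (s * s * ln (s * s)) <= 2 * s.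
  rewrite lnM ?posrE//.
  have := ler_wpM2l (ltW s0) l2; rewrite divff ?gt_eqF// => h1.
  have := ler_wpM2l (ltW s0) h1; lra.
lra.
Qed.

End finite_entropy.

(** * Independent samples from a finite distribution *)

Section samples.
Context {R : realType} (m : nat).

(** The weight of a family [v] of [m] independent samples of law [g]. *)
Definition sample_weight (V : finType) (g : V -> R) (v : {ffun 'I_m -> V}) : R :=
  \prod_(j < m) g (v j).

Section one_law.
Context {V : finType} (g : V -> R).
Hypothesis g1 : \sum_u g u = 1.

Lemma sum_sample_prod (f : 'I_m -> V -> R) :
  \sum_v sample_weight g v * \prod_j f j (v j) = \prod_j \sum_u g u * f j u.
Proof.
by rewrite bigA_distr_bigA; apply: eq_bigr => v _; rewrite /sample_weight big_split.
Qed.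

Lemma sum_sample : \sum_v sample_weight g v = 1.
Proof. by rewrite /sample_weight -(bigA_distr_bigA (fun=> g)) big1. Qed.

Lemma sample_marginal (k : 'I_m) (f : V -> R) :
  \sum_v sample_weight g v * f (v k) = \sum_u g u * f u.
Proof.
pose F j u := if j == k then f u else 1.
transitivity (\sum_v sample_weight g v * \prod_j F j (v j)).
  apply: eq_bigr => v _; congr (_ * _).
  by rewrite (bigD1 k)//= big1 /F ?eqxx ?mulr1// => j /negbTE ->.
rewrite sum_sample_prod (bigD1 k)//= [X in _ * X]big1 /F ?eqxx ?mulr1// => j.
by move=> /negbTE ->; under eq_bigr do rewrite mulr1.
Qed.

Lemma sample_marginal2 (k l : 'I_m) (f h : V -> R) : k != l ->
  \sum_v sample_weight g v * (f (v k) * h (v l)) =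
  (\sum_u g u * f u) * (\sum_u g u * h u).
Proof.
move=> kl.
pose F j u := if j == k then f u else if j == l then h u else 1.
have lk : (l == k) = false by rewrite eq_sym (negbTE kl).
transitivity (\sum_v sample_weight g v * \prod_j F j (v j)).
  apply: eq_bigr => v _; congr (_ * _).
  rewrite (bigD1 k)//= (bigD1 l) ?lk//= big1 /F ?eqxx ?lk ?mulr1//.
  by move=> j /andP[/negbTE -> /negbTE ->].
rewrite sum_sample_prod (bigD1 k)//= (bigD1 l) ?lk//= [X in _ * (_ * X)]big1 /F.
  by rewrite !eqxx lk mulr1.
by move=> j /andP[/negbTE -> /negbTE ->]; under eq_bigr do rewrite mulr1.
Qed.

(** Images of independent samples are independent samples of the image law. *)
Lemma sample_image (U : finType) (s : V -> U) (f : {ffun 'I_m -> U} -> R) :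
  \sum_v sample_weight g v * f [ffun j => s (v j)] =
  \sum_a sample_weight (fun b => \sum_(u | s u == b) g u) a * f a.
Proof.
rewrite (partition_big (fun v : {ffun 'I_m -> V} => [ffun j => s (v j)]) xpredT)//=.
apply: eq_bigr => a _; rewrite /sample_weight bigA_distr_big_dep mulr_suml.
apply: eq_big => [v|v /eqP -> //].
apply/eqP/familyP => [<- j|va]; first by rewrite ffunE; exact: eqxx.
by apply/ffunP => j; rewrite ffunE; exact/eqP/va.
Qed.

End one_law.

(** The proportion of successes among [m] trials. *)
Definition sample_mean (a : {ffun 'I_m -> bool}) : R :=
  (\sum_j (a j)%:R) / m%:R.

Lemma sample_variance (b : bool -> R) : (0 < m)%N -> \sum_u b u = 1 ->
  \sum_a sample_weight b a * (sample_mean a - b true) ^+ 2 =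
  b true * (1 - b true) / m%:R.
Proof.
move=> m0 b1; have mR : m%:R != 0 :> R by rewrite pnatr_eq0 -lt0n.
have bf : b false = 1 - b true.
  by move: b1; rewrite big_bool => <-; rewrite addrAC subrr add0r.
pose x (c : bool) : R := c%:R - b true.
have x0 : \sum_u b u * x u = 0.
  by rewrite big_bool/= bf /x/=; ring.
have x2 : \sum_u b u * (x u * x u) = b true * (1 - b true).
  by rewrite big_bool/= bf /x/=; ring.
have meanE a : sample_mean a - b true = (\sum_j x (a j)) / m%:R.
  rewrite /sample_mean /x sumrB mulrBl sumr_const card_ord -[b true *+ m]mulr_natr.
  by rewrite mulfK.
have sqE a : sample_weight b a * (sample_mean a - b true) ^+ 2 =
    (\sum_j \sum_k sample_weight b a * (x (a j) * x (a k))) / m%:R ^+ 2.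
  rewrite meanE expr_div_n mulrA expr2; congr (_ / _).
  rewrite mulr_suml mulr_sumr; apply: eq_bigr => j _.
  by rewrite mulr_sumr mulr_sumr.
under eq_bigr do rewrite sqE.
rewrite -mulr_suml exchange_big/=.
rewrite (_ : \sum_j _ = \sum_(j < m) b true * (1 - b true)).
  rewrite sumr_const card_ord -mulr_natr; by field.
apply: eq_bigr => j _; rewrite exchange_big/= (bigD1 j)//=.
rewrite (@sample_marginal _ b b1 j (fun u => x u * x u)) x2 big1 ?addr0//.
by move=> k kj; rewrite sample_marginal2 1?eq_sym// x0 mul0r.
Qed.

(** Deciding whether [b true] exceeds [c] from the sample mean fails with small
    probability, unless [b true] lies just above [c]. *)
Lemma sample_test_error (b : bool -> R) (c eta : R) : (0 < m)%N -> 0 < eta ->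
  (forall u, 0 <= b u) -> \sum_u b u = 1 -> ~~ (c < b true <= c + eta) ->
  \sum_a sample_weight b a *
    ((c < b true) != (c + eta / 2 < sample_mean a))%:R
  <= (m%:R * eta ^+ 2)^-1.
Proof.
move=> m0 eta0 b0 b1 far; have mR : 0 < m%:R :> R by rewrite ltr0n.
have w0 a : 0 <= sample_weight b a by exact: prodr_ge0.
have b01 : b true <= 1 by rewrite -b1 big_bool/= lerDl.
pose d := (eta / 2) ^+ 2; have d0 : 0 < d by rewrite exprn_gt0// divr_gt0.
apply: (@le_trans _ _ (\sum_a sample_weight b a *
    (sample_mean a - b true) ^+ 2 / d)).
  apply: ler_sum => a _; rewrite -mulrA ler_wpM2l//.
  set s := sample_mean a; rewrite ler_pdivlMr//.
  move: far; have [cf|cf] := ltP c (b true); have [cs|cs] := ltP (c + eta / 2) s;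
    rewrite ?mul0r ?mul1r ?sqr_ge0//= -?ltNge => far.
    by rewrite /d -[(s - _) ^+ 2]sqrrN opprB lerXn2r// ?nnegrE; lra.
  by rewrite /d lerXn2r// ?nnegrE; lra.
rewrite -mulr_suml sample_variance//.
rewrite ler_pdivrMr// ler_pdivrMr// /d.
have -> : (m%:R * eta ^+ 2)^-1 * (eta / 2) ^+ 2 * m%:R = 1 / 4 :> R.
  by field; rewrite !gt_eqF.
have := sqr_ge0 (b true - 1 / 2); rewrite expr2; nra.
Qed.

End samples.

(** * Coding a thresholded conditional expectation by samples *)

Section real_integrals.
Context {R : realType} {d} {Om : measurableType d} (nu : probability Om R).
Implicit Types (f : Om -> R).

Lemma integrable_bounded f (M : R) : measurable_fun setT f ->
  (forall x, `|f x| <= M) -> nu.-integrable setT (EFin \o f).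
Proof.
move=> mf fM; apply: measurable_bounded_integrable => //.
  by rewrite [X in (X < _)%E]probability_setT ltry.
exists M; split; first exact: num_real.
by move=> N MN x _; exact: le_trans (fM x) (ltW MN).
Qed.

Lemma integrable_real_sum (I : finType) (F : I -> Om -> R) :
  (forall i, nu.-integrable setT (EFin \o F i)) ->
  nu.-integrable setT (EFin \o (fun x => \sum_i F i x)).
Proof.
move=> iF; rewrite (_ : _ \o _ = fun x => (\sum_i (F i x)%:E)%E).
  by apply: integrable_sum => // i _; exact: iF.
by apply/funext => x /=; rewrite sumEFin.
Qed.

Lemma integrable_realZ f (k : R) : nu.-integrable setT (EFin \o f) ->
  nu.-integrable setT (EFin \o (fun x => k * f x)).
Proof. by move=> /(integrableZl measurableT k). Qed.

Lemma integrable_realD f1 f2 : nu.-integrable setT (EFin \o f1) ->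
  nu.-integrable setT (EFin \o f2) ->
  nu.-integrable setT (EFin \o (fun x => f1 x + f2 x)).
Proof. by move=> i1 i2; have := integrableD measurableT i1 i2. Qed.

Lemma Rintegral_sum (I : finType) (F : I -> Om -> R) :
  (forall i, nu.-integrable setT (EFin \o F i)) ->
  (\int[nu]_x (\sum_i F i x) = \sum_i \int[nu]_x F i x)%R.
Proof.
move=> iF; rewrite /Rintegral; under eq_integral do rewrite -sumEFin.
rewrite integral_sum// sum_fine// => i _.
by apply: integrable_fin_num => //; exact: iF.
Qed.

Lemma Rintegral_indicator (A : set Om) : measurable A ->
  (\int[nu]_x (\1_A x : R) = fine (nu A))%R.
Proof. by move=> mA; rewrite /Rintegral integral_indic// setIT. Qed.

End real_integrals.

Section coding.
Context {R : realType} {d} {Om : measurableType d} (nu : probability Om R).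
Context {n m : nat} (g : {ffun 'I_n -> bool} -> Om -> R).
Context (X : Om -> {ffun 'I_n -> bool}) (c eta delta e : R).
Hypothesis m_gt0 : (0 < m)%N.
Hypothesis eta_gt0 : 0 < eta.
Hypothesis e01 : 0 < e < 1.
Hypothesis mg : forall u, measurable_fun setT (g u).
Hypothesis g_ge0 : forall u x, 0 <= g u x.
Hypothesis g_sum : forall x, \sum_u g u x = 1.
Hypothesis mX : forall w, measurable (X @^-1` [set w]).

Let f (i : 'I_n) x := \sum_(u : {ffun 'I_n -> bool} | u i) g u x.
Let band (i : 'I_n) := [set x | c < f i x <= c + eta].

Hypothesis XE : forall x i, X x i = (c < f i x).
Hypothesis band_small : forall i, fine (nu (band i)) <= delta.
Hypothesis e_large : (m%:R * eta ^+ 2)^-1 + delta <= e.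

Let q u := (\int[nu]_x g u x)%R.

(* The test of [sample_test_error], and the probability of a letter given the
   value of the test. *)
Let guess (a : {ffun 'I_m -> bool}) := c + eta / 2 < sample_mean (R := R) a.
Let kappa (b : bool) (a : {ffun 'I_m -> bool}) : R :=
  if b == guess a then 1 - e else e.
Let column (i : 'I_n) (v : {ffun 'I_m -> {ffun 'I_n -> bool}}) :
  {ffun 'I_m -> bool} := [ffun j => v j i].

Let weight x (v : {ffun 'I_m -> {ffun 'I_n -> bool}}) := sample_weight (g^~ x) v.

(* The joint law of the word [X] and of [m] samples, and the model for it in
   which the samples are independent and the letters of [X] are independently
   flipped copies of the guesses. *)
Let joint w (v : {ffun 'I_m -> {ffun 'I_n -> bool}}) :=
  (\int[nu]_x (\1_(X @^-1` [set w]) x * weight x v))%R.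
Let model (w : {ffun 'I_n -> bool}) (v : {ffun 'I_m -> {ffun 'I_n -> bool}}) :=
  \prod_j q (v j) * \prod_i kappa (w i) (column i v).
Let cost (w : {ffun 'I_n -> bool}) (v : {ffun 'I_m -> {ffun 'I_n -> bool}}) :=
  \sum_j - ln (q (v j)) + \sum_i - ln (kappa (w i) (column i v)).

Let g_le1 u x : g u x <= 1.
Proof. by rewrite -(g_sum x) (bigD1 u)//= lerDl sumr_ge0. Qed.

Let ig u : nu.-integrable setT (EFin \o g u).
Proof.
by apply: (@integrable_bounded _ _ _ _ _ 1) => // x; rewrite ger0_norm.
Qed.

Let weight_ge0 x v : 0 <= weight x v.
Proof. exact: prodr_ge0. Qed.

Let weight_sum x : \sum_v weight x v = 1.
Proof. exact: sum_sample. Qed.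

Let weight_le1 x v : weight x v <= 1.
Proof. by rewrite -(weight_sum x) (bigD1 v)//= lerDl sumr_ge0. Qed.

Let mweight v : measurable_fun setT (weight ^~ v).
Proof. by apply: measurable_prod => j _. Qed.

Let ijoint w v : nu.-integrable setT
  (EFin \o (fun x => \1_(X @^-1` [set w]) x * weight x v)).
Proof.
apply: (@integrable_bounded _ _ _ _ _ 1) => [|x].
  by apply: measurable_funM => //; exact: measurable_indic.
by rewrite ger0_norm ?mulr_ge0// mulr_ile1// indicE; case: (_ \in _).
Qed.

Let joint_ge0 w v : 0 <= joint w v.
Proof. by apply: Rintegral_ge0 => x _; rewrite mulr_ge0. Qed.

Let joint_le w v j : joint w v <= q (v j).
Proof.
apply: le_Rintegral => // x _.
apply: (@le_trans _ _ (1 * weight x v)).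
  by rewrite ler_wpM2r// indicE; case: (_ \in _).
rewrite mul1r /weight /sample_weight (bigD1 j)//= ler_piMr//.
by apply: prodr_ile1 => k; rewrite g_ge0 g_le1.
Qed.

Let q_ge0 u : 0 <= q u.
Proof. by apply: Rintegral_ge0 => x _. Qed.

Let q_sum : \sum_u q u = 1.
Proof.
rewrite -Rintegral_sum//; under eq_Rintegral do rewrite g_sum.
by rewrite Rintegral_cst//= probability_setT mulr1.
Qed.

Let kappa_gt0 b a : 0 < kappa b a.
Proof. by rewrite /kappa; case: ifP => _; move: e01 => /andP[]; lra. Qed.

Let model_sum : \sum_w \sum_v model w v = 1.
Proof.
rewrite exchange_big/= -[RHS](sum_sample m q_sum); apply: eq_bigr => v _.
rewrite -mulr_sumr -(bigA_distr_bigA (fun i b => kappa b (column i v))).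
rewrite [X in _ * X]big1 ?mulr1// => i _; rewrite big_bool /kappa.
by case: (guess _) => /=; rewrite ?subrK// addrC subrK.
Qed.

Let joint_marginal w : \sum_v joint w v = fine (nu (X @^-1` [set w])).
Proof.
rewrite -Rintegral_sum// -Rintegral_indicator//; apply: eq_Rintegral => x _.
by rewrite -mulr_sumr weight_sum mulr1.
Qed.

Let joint_sum : \sum_w \sum_v joint w v = 1.
Proof.
under eq_bigr do rewrite -Rintegral_sum//.
rewrite -Rintegral_sum; last by move=> w; exact: integrable_real_sum.
transitivity (fine (nu setT)); last by rewrite probability_setT.
rewrite -Rintegral_indicator//.
apply: eq_Rintegral => x _; rewrite indicT (bigD1 (X x))//= [X in _ + X]big1 ?addr0.
  by rewrite -mulr_sumr weight_sum mulr1 indicE mem_set.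
move=> w wX; rewrite -mulr_sumr indicE memNset ?mul0r//= => h.
by rewrite h eqxx in wX.
Qed.

Let model_ge0 w v : 0 <= model w v.
Proof. by rewrite mulr_ge0// prodr_ge0// => i _; exact: ltW. Qed.

Let model0 w v : model w v = 0 -> joint w v = 0.
Proof.
move=> /eqP; rewrite mulf_eq0 => /orP[|]; rewrite prodf_seq_eq0.
  move=> /hasP[j _ /andP[_ /eqP qj]]; apply/eqP.
  by rewrite eq_le joint_ge0 andbT -qj.
by move=> /hasP[i _]; rewrite gt_eqF.
Qed.

Let joint_cost w v : joint w v * - ln (model w v) = joint w v * cost w v.
Proof.
have [->|jN0] := eqVneq (joint w v) 0; first by rewrite !mul0r.
have qpos j : 0 < q (v j).
  by apply: lt_le_trans (joint_le w v j); rewrite lt_neqAle eq_sym jN0 joint_ge0.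
have lnprod (I : finType) (F : I -> R) : (forall i, 0 < F i) ->
    ln (\prod_i F i) = \sum_i ln (F i).
  move=> F0; suff [] : 0 < \prod_i F i /\ ln (\prod_i F i) = \sum_i ln (F i) by [].
  apply: (big_rec2 (fun a b => 0 < a /\ ln a = b)); first by rewrite ln1.
  by move=> i y1 y2 _ [y10 <-]; rewrite lnM ?posrE// mulr_gt0.
rewrite /cost !sumrN -opprD /model lnM ?posrE ?lnprod//.
  by rewrite prodr_gt0.
by rewrite prodr_gt0.
Qed.

Let letter_error i x :
  \sum_v weight x v * (X x i != guess (column i v))%:R <=
  (m%:R * eta ^+ 2)^-1 + \1_(band i) x.
Proof.
rewrite (sample_image (g^~ x) (fun u => u i) (fun a => (X x i != guess a)%:R)).
set b := (fun b => \sum_(u : {ffun 'I_n -> bool} | u i == b) g u x).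
have b0 t : 0 <= b t by exact: sumr_ge0.
have bT : b true = f i x by apply: eq_bigl => u; rewrite eqb_id.
have b1 : \sum_t b t = 1.
  by rewrite -(g_sum x) [RHS](partition_big
    (fun u : {ffun 'I_n -> bool} => u i) xpredT).
have pos : 0 <= (m%:R * eta ^+ 2)^-1 :> R.
  by rewrite invr_ge0 mulr_ge0// sqr_ge0.
rewrite indicE; have [xb|xb] := boolP (x \in band i).
  apply: (@le_trans _ _ (\sum_a sample_weight b a)); last first.
    by rewrite sum_sample// lerDr.
  apply: ler_sum => a _; rewrite ler_piMr//; first exact: prodr_ge0.
  by case: (_ != _).
rewrite addr0; under eq_bigr do rewrite XE -bT; apply: sample_test_error => //.
by apply: contra xb; rewrite inE/= bT.
Qed.

Let letter_cost i x :
  \sum_v weight x v * - ln (kappa (X x i) (column i v)) <=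
  - ln (1 - e) + ((m%:R * eta ^+ 2)^-1 + \1_(band i) x) * - ln e.
Proof.
have [e0 e1] := andP e01.
have l1 : ln (1 - e) <= 0 by apply: ln_le0; lra.
have l2 : 0 <= - ln e by rewrite oppr_ge0 ln_le0// ltW.
apply: (@le_trans _ _ (\sum_v (weight x v * - ln (1 - e) +
   weight x v * (X x i != guess (column i v))%:R * - ln e))).
  apply: ler_sum => v _; rewrite -mulrA -mulrDr ler_wpM2l// /kappa.
  by case: eqP => _ /=; rewrite ?mul0r ?addr0// mul1r lerDr oppr_ge0.
rewrite big_split/= -!mulr_suml weight_sum mul1r lerD2l.
by rewrite ler_wpM2r// letter_error.
Qed.

Let mband i : measurable (band i).
Proof.
rewrite (_ : band i = f i @^-1` `]c, c + eta]).
  rewrite -[X in measurable X]setTI.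
  have : measurable_fun setT (f i).
    rewrite (_ : f i = fun x => \sum_(u : {ffun 'I_n -> bool}) (u i)%:R * g u x).
      by apply: measurable_sum => u; exact: measurable_funM.
    by apply/funext => x; rewrite /f big_mkcond; apply: eq_bigr => u _; case: (u i);
      rewrite ?mul1r ?mul0r.
  by apply.
by apply/seteqP; split=> x /=; rewrite in_itv.
Qed.

(** The point [x] is given a random word of law [g^~ x]. If each letter of the
    word [X x] records whether the conditional
    probability [f i x] that the [i]-th letter of the random word is a one
    exceeds [c], then the entropy of [X] is little more than that of [m] copies
    of the random word, whose law is [q]. *)
Lemma entropy_threshold_le :
  entropy (fun w => fine (nu (X @^-1` [set w]))) <=
  m%:R * entropy q + n%:R * (- ln (1 - e) - e * ln e).
Proof.
have [e0 e1] := andP e01.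
have l2 : 0 <= - ln e by rewrite oppr_ge0 ln_le0// ltW.
rewrite (_ : (fun w => _) = fun w => \sum_v joint w v); last first.
  by apply/funext => w; rewrite joint_marginal.
apply: (le_trans (entropy_marginal_le joint_ge0 model_ge0 model0 _)).
  by rewrite model_sum joint_sum.
rewrite (eq_bigr (fun w => (\int[nu]_x \sum_v
    cost w v * (\1_(X @^-1` [set w]) x * weight x v))%R)); last first.
  move=> w _; rewrite Rintegral_sum => [|v]; last exact: integrable_realZ.
  by apply: eq_bigr => v _; rewrite joint_cost mulrC RintegralZl.
rewrite -Rintegral_sum; last first.
  by move=> w; apply: integrable_real_sum => v; exact: integrable_realZ.
(* The expected costs, at the point [x], of the samples and of the letters. *)
pose A x := \sum_(j < m) \sum_u - ln (q u) * g u x.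
pose K := - ln (1 - e) + (m%:R * eta ^+ 2)^-1 * - ln e.
pose B x := \sum_(i < n) (K + - ln e * \1_(band i) x).
have iA : nu.-integrable setT (EFin \o A).
  by do 2 (apply: integrable_real_sum => ?); exact: integrable_realZ.
have iind i : nu.-integrable setT (EFin \o \1_(band i)) by exact: integrable_indic.
have iK : nu.-integrable setT (EFin \o (fun=> K)).
  by apply: (@integrable_bounded _ _ _ _ _ `|K|).
have iB1 i : nu.-integrable setT (EFin \o (fun x => K + - ln e * \1_(band i) x)).
  exact: (integrable_realD iK (integrable_realZ _ (iind i))).
have iB : nu.-integrable setT (EFin \o B) by exact: integrable_real_sum.
apply: (@le_trans _ _ (\int[nu]_x (A x + B x))%R).
  apply: le_Rintegral => //.
  - by do 2 (apply: integrable_real_sum => ?); exact: integrable_realZ.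
  - exact: integrable_realD.
  move=> x _; rewrite (bigD1 (X x))//= [X in _ + X]big1 ?addr0; last first.
    move=> w wX; apply: big1 => v _; rewrite indicE memNset ?mul0r ?mulr0//=.
    by move=> h; rewrite h eqxx in wX.
  rewrite (eq_bigr (fun v => weight x v * \sum_j - ln (q (v j)) +
      \sum_i weight x v * - ln (kappa (X x i) (column i v)))); last first.
    by move=> v _; rewrite indicE mem_set// mul1r mulrC mulrDr [X in _ + X]mulr_sumr.
  rewrite big_split/= lerD//.
    under eq_bigr do rewrite mulr_sumr.
    rewrite exchange_big/=; apply: ler_sum => j _.
    rewrite (sample_marginal (g_sum x) j (fun u => - ln (q u))).
    by under eq_bigr do rewrite mulrC.
  rewrite exchange_big/=; apply: ler_sum => i _.
  apply: (le_trans (letter_cost i x)); rewrite /K mulrDl addrA.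
  by rewrite [\1_(band i) x * _]mulrC.
rewrite RintegralD// lerD//.
  rewrite Rintegral_sum => [|j]; last first.
    by apply: integrable_real_sum => u; exact: integrable_realZ.
  rewrite sumr_const card_ord -[leLHS]mulr_natl ler_wpM2l// Rintegral_sum; last first.
    by move=> u; exact: integrable_realZ.
  rewrite /entropy -sumrN; apply: ler_sum => u _.
  by rewrite RintegralZl// mulNr mulrC.
rewrite Rintegral_sum// -[X in X%:R]card_ord -sum1_card natr_sum mulr_suml.
apply: ler_sum => i _; rewrite mul1r RintegralD//; last first.
  exact: (integrable_realZ _ (iind i)).
rewrite RintegralZl// Rintegral_cst//= probability_setT mulr1 Rintegral_indicator//.
rewrite /K; have := ler_wpM2r l2 e_large.
have := ler_wpM2r l2 (band_small i); lra.
Qed.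

End coding.

(** * Words of a process and their entropy *)

(** Fekete's lemma for nonnegative sequences. *)
Lemma subadditive_cvg (R : realType) (a : nat -> R) :
  (forall n, 0 <= a n) -> (forall n k, a (n + k)%N <= a n + a k) ->
  cvgn (fun n => n%:R^-1 * a n).
Proof.
move=> a0 asub; pose A := [set n%:R^-1 * a n | n in [set n | (0 < n)%N]].
have lbA : has_lbound A by exists 0 => _ [n _ <-]; rewrite mulr_ge0// invr_ge0.
have infA : has_inf A by split => //; exists (1%:R^-1 * a 1%N), 1%N.
have amul p q r : a (q * p + r)%N <= q%:R * a p + a r.
  elim: q => [|q ih]; first by rewrite mul0r add0r mul0n.
  rewrite mulSn -addnA (le_trans (asub _ _))// -natr1 mulrDl mul1r.
  by rewrite addrAC addrC lerD2l.
apply/cvg_ex; exists (inf A); apply/cvgrPdist_le => eps eps0.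
have [_ [p /= p0 <-] pA] := inf_adherent (divr_gt0 eps0 (ltr0Sn _ 1)) infA.
(* A bound for the terms of index less than [p]. *)
pose C := \sum_(r < p) a r.
have C0 : 0 <= C by exact: sumr_ge0.
have [N hN] : exists N : nat, C / (eps / 2) < N%:R.
  by eexists; apply: archi_boundP; rewrite divr_ge0// divr_ge0// ltW.
near=> n.
have n0 : (0 < n)%N by near: n; exact: nbhs_infty_gt.
have nN : (N <= n)%N by near: n; exact: nbhs_infty_ge.
have nR : 0 < n%:R :> R by rewrite ltr0n.
have pR : 0 < p%:R :> R by rewrite ltr0n.
have le1 : inf A <= n%:R^-1 * a n by apply: ge_inf => //; exists n.
rewrite ler0_norm ?subr_le0// opprB lerBlDr.
have le2 : a n <= n%:R * (p%:R^-1 * a p) + C.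
  rewrite {1}(divn_eq n p); apply: (le_trans (amul _ _ _)); apply: lerD.
    rewrite mulrA ler_wpM2r// ler_pdivlMr// -natrM ler_nat; exact: leq_divM.
  rewrite /C (bigD1 (Ordinal (ltn_pmod n p0)))//= lerDl; exact: sumr_ge0.
have le3 : C <= n%:R * (eps / 2).
  rewrite -ler_pdivrMr ?divr_gt0//; apply: (le_trans (ltW hN)).
  by rewrite ler_nat.
rewrite mulrC ler_pdivrMr//; apply: (le_trans le2).
have := ler_wpM2l (ltW nR) (ltW pA); lra.
Unshelve. all: by end_near. Qed.

Section words.
Context {R : realType} {d} {Y : measurableType d} (P : probability Y R).

(** Probabilities of events that depend on a variable with finitely many
    values are sums of the probabilities of its values. *)
Lemma sum_fiber_measure (W : finType) (X : Y -> W) (S : pred W) :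
  (forall w, measurable (X @^-1` [set w])) ->
  \sum_(w | S w) fine (P (X @^-1` [set w])) = fine (P [set y | S (X y)]).
Proof.
move=> mX.
have AE : [set y | S (X y)] = \bigcup_(w in [set w | S w]) (X @^-1` [set w]).
  by apply/seteqP; split=> [y Sy|y [w Sw /= ->]//]; exists (X y).
have mA : measurable [set y | S (X y)].
  by rewrite AE; apply: fin_bigcup_measurable; [exact: finite_finset|move=> w _].
rewrite -Rintegral_indicator// big_mkcond/=.
rewrite (eq_bigr (fun w =>
    (\int[P]_y ((S w)%:R * \1_(X @^-1` [set w]) y))%R)); last first.
  move=> w _; rewrite RintegralZl//; last exact: integrable_indic.
  by rewrite Rintegral_indicator//; case: (S w); rewrite ?mul1r ?mul0r.
rewrite -Rintegral_sum; last first.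
  by move=> w; apply: integrable_realZ; exact: integrable_indic.
apply: eq_Rintegral => y _; rewrite (bigD1 (X y))//= [X in _ + X]big1 ?addr0.
  rewrite [X in _ * X]indicE mem_set//= mulr1 indicE; congr (_%:R).
  by case: (boolP (S (X y))) => [Sy|/negP Sy]; [rewrite mem_set|rewrite memNset].
by move=> w wX; rewrite indicE memNset ?mulr0//= => h; rewrite h eqxx in wX.
Qed.

Lemma measurable_word_fiber (J : finType) (X : Y -> {ffun J -> bool}) w :
  (forall i, measurable [set y | X y i]) -> measurable (X @^-1` [set w]).
Proof.
move=> mX; rewrite (_ : X @^-1` [set w] =
  \bigcap_(i in [set: J]) if w i then [set y | X y i] else ~` [set y | X y i]).
  apply: fin_bigcap_measurable; first exact: finite_finset.
  by move=> i _; case: ifP => _ //; exact: measurableC.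
apply/seteqP; split => [y /= <- i _|y h].
  by case: ifPn => //= /negP.
apply/ffunP => i; have := h i I; case: (w i) => //= /negP.
by move=> /negbTE.
Qed.

Context (S : Y -> Y) (F : set Y).

(** The word that records the visits to [F] along the first [n] points of an
    orbit; its fibers are the cells of the refined partition. *)
Definition itinerary n y : {ffun 'I_n -> bool} :=
  [ffun k : 'I_n => `[< F (iter k S y) >]].

Lemma refinement_itinerary n (w : {ffun 'I_n -> bool}) :
  refinement S (bipartition F) w = itinerary n @^-1` [set w].
Proof.
apply/seteqP; split=> y.
  move=> /= h; apply/ffunP => k; rewrite ffunE; have := h k; rewrite /bipartition.
  by case: (w k) => /= Fk; apply/asboolP.
move=> /= <- k; rewrite ffunE /bipartition.
by case: asboolP.
Qed.

(** The entropy, in nats, of the words of length [n]. *)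
Definition word_entropy n :=
  entropy (fun w : {ffun 'I_n -> bool} => fine (P (itinerary n @^-1` [set w]))).

Lemma ks_entropy_word :
  ks_entropy P S (bipartition F) =
  limn (fun n => n%:R^-1 * word_entropy n / ln 2).
Proof.
congr (limn _); apply/funext => n; rewrite -mulrA; congr (_ * _).
rewrite /partition_entropy /word_entropy /entropy mulNr; congr (- _).
rewrite mulr_suml; apply: eq_bigr => w _.
by rewrite refinement_itinerary /log2 mulrA.
Qed.

Lemma invariant_iter k (A : set Y) : invariant_measure P S ->
  (forall k, measurable (iter k S @^-1` A)) -> P (iter k S @^-1` A) = P A.
Proof.
move=> invS mA; elim: k => [//|k ih].
rewrite -[RHS]ih -[RHS]invS//; congr (P _).
by apply/seteqP; split => y /=; rewrite -iterSr.
Qed.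

Hypothesis mF : forall k, measurable (iter k S @^-1` F).

Lemma measurable_itinerary n w : measurable (itinerary n @^-1` [set w]).
Proof.
apply: measurable_word_fiber => i; rewrite (_ : [set y | _] = iter i S @^-1` F)//.
by apply/seteqP; split => y /=; rewrite ffunE => /asboolP.
Qed.

Lemma word_probability n w : 0 <= fine (P (itinerary n @^-1` [set w])) <= 1.
Proof.
rewrite fine_ge0//= -lee_fin fineK; first exact/probability_le1/measurable_itinerary.
by apply: fin_num_measure; exact: measurable_itinerary.
Qed.

Lemma word_entropy_ge0 n : 0 <= word_entropy n.
Proof. by apply: entropy_ge0 => w; exact: word_probability. Qed.

Lemma word_entropy_subadditive n k :
  (forall A, measurable A -> measurable (S @^-1` A)) -> invariant_measure P S ->
  word_entropy (n + k) <= word_entropy n + word_entropy k.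
Proof.
move=> mS invS.
pose f (w : {ffun 'I_(n + k) -> bool}) := [ffun i : 'I_n => w (lshift k i)].
pose g (w : {ffun 'I_(n + k) -> bool}) := [ffun i : 'I_k => w (rshift n i)].
have mit l w := @measurable_itinerary l w.
apply: (le_trans (@entropy_pair_le _ _ _ _ f g _ _ _ _)).
- move=> w w' [/ffunP fw /ffunP gw]; apply/ffunP => i.
  case: (split_ordP i) => j ->; first by have := fw j; rewrite !ffunE.
  by have := gw j; rewrite !ffunE.
- by move=> w; have /andP[] := word_probability w.
- rewrite (sum_fiber_measure xpredT (mit (n + k)%N)).
  by rewrite [X in P X](_ : _ = setT) ?probability_setT//; apply/seteqP.
apply: lerD; rewrite [leRHS]/word_entropy le_eqVlt; apply/orP; left; apply/eqP;
  congr entropy; apply/funext => w.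
  rewrite (sum_fiber_measure (fun v => f v == w) (mit _)).
  congr (fine (P _)); apply/seteqP; split => y /=.
    by move=> /eqP <-; apply/ffunP => i; rewrite !ffunE.
  by move=> <-; apply/eqP/ffunP => i; rewrite !ffunE.
rewrite (sum_fiber_measure (fun v => g v == w) (mit _)).
rewrite -(@invariant_iter n (itinerary k @^-1` [set w]))//; last first.
  move=> l; elim: l => [|l ih]; first exact: mit.
  rewrite (_ : _ @^-1` _ = S @^-1` (iter l S @^-1` (itinerary k @^-1` [set w]))).
    exact: mS.
  by apply/seteqP; split => y /=; rewrite -iterSr.
congr (fine (P _)); apply/seteqP; split => y /=.
  move=> /eqP <-; apply/ffunP => i; rewrite !ffunE /=.
  by rewrite addnC iterD.
move=> <-; apply/eqP/ffunP => i; rewrite !ffunE /=.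
by rewrite addnC iterD.
Qed.

End words.

(** * The space of Borel probability measures *)

Section measures.
Context {R : realType} {X : pmetricType R}.
Implicit Types (A : set X) (theta : pmeas R X).

Lemma measurable_open A : open A -> measurable (A : set (borel X)).
Proof. exact: sub_sigma_algebra. Qed.

(** The points at distance at least [e] from the complement of [A]. *)
Definition inner_part A (e : R) : set X := ~` nbhd_of (~` A) e.

Lemma open_nbhd_of A e : open (nbhd_of A e).
Proof.
apply: bigcup_open => a _; rewrite openE => x /=; rewrite ballEmdist/= => ax.
apply/nbhs_ballP; exists (e - mdist a x) => /=; first by rewrite subr_gt0.
move=> y; rewrite !ballEmdist/= => xy.
by rewrite (le_lt_trans (metric_triangle a x y))// -ltrBrDl.
Qed.

Lemma closed_inner_part A e : closed (inner_part A e).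
Proof. by apply: open_closedC; exact: open_nbhd_of. Qed.

Lemma measurable_inner_part A e : measurable (inner_part A e : set (borel X)).
Proof. by apply: measurableC; apply: measurable_open; exact: open_nbhd_of. Qed.

Lemma inner_part_sub A e : 0 < e -> inner_part A e `<=` A.
Proof.
move=> e0 x Ax; apply: contrapT => nAx; apply: Ax.
by exists x => //; exact: ballxx.
Qed.

Lemma nbhd_inner_part A e : nbhd_of (inner_part A e) e `<=` A.
Proof.
move=> x [y Ay yx]; apply: contrapT => nAx; apply: Ay.
by exists x => //; exact: ball_sym.
Qed.

Lemma bigcup_inner_part A : open A ->
  \bigcup_k inner_part A k.+1%:R^-1 = A.
Proof.
move=> oA; apply/seteqP; split => [x [k _]|x Ax]; first exact: inner_part_sub.
have /nbhs_ballP[e /= e0 eA] : nbhs x A by exact: open_nbhs_nbhs.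
have [k ke] : exists k : nat, k.+1%:R^-1 < e.
  by have [k _ /(_ k (leqnn k))] := near_infty_natSinv_lt (PosNum e0); exists k.
exists k => // -[y nAy /ball_sym yx]; apply: nAy; apply: eA.
exact: le_ball (ltW ke) _ yx.
Qed.

Lemma nondecreasing_inner_part A :
  nondecreasing_seq (fun k => inner_part A k.+1%:R^-1).
Proof.
move=> i j ij; apply/subsetPset => x Ax -[y nAy yx]; apply: Ax; exists y => //.
apply: le_ball yx; by rewrite lef_pV2 ?posrE// ler_nat ltnS.
Qed.

Lemma cvg_inner_part (P : {measure set (borel X) -> \bar R}) A : open A ->
  P (inner_part A k.+1%:R^-1) @[k --> \oo] --> P A.
Proof.
move=> oA; rewrite -[X in _ --> P X](bigcup_inner_part oA).
apply: (nondecreasing_cvg_mu (mu := P)).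
- by move=> k; exact: measurable_inner_part.
- by rewrite bigcup_inner_part//; exact: measurable_open.
- exact: nondecreasing_inner_part.
Qed.

Lemma ball_prohorov theta nu d : ball theta d nu ->
  exists2 e, 0 < e < d & prohorov_le theta nu e.
Proof.
rewrite ballEmdist/= => /inf_lt[].
  exists 1; split => // A mA; apply: (le_trans (probability_le1 _ mA)).
  by rewrite leeDr.
by move=> e [e0 le_e] ed; exists e; rewrite ?e0.
Qed.

(** Evaluation at an open set is lower semicontinuous. *)
Lemma open_evaluation_gt A (r : R) : open A ->
  open [set theta : pmeas R X | (r%:E < theta (A : set (borel X)))%E].
Proof.
move=> oA; rewrite openE => theta /= rA.
have [k rk] : exists k, (r%:E < theta (inner_part A k.+1%:R^-1 : set (borel X)))%E.
  apply: contrapT => /forallNP h; move: rA; apply/negP; rewrite -leNgt.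
  rewrite -(cvg_lim _ (cvg_inner_part (P := theta) oA))//; apply: lime_le.
    by apply/cvg_ex; exists (theta A); exact: cvg_inner_part.
  by apply: nearW => k; rewrite leNgt; apply/negP/h.
have mI := measurable_inner_part A k.+1%:R^-1.
move: rk; set t := theta _; have ft : t \is a fin_num by exact: fin_num_measure.
rewrite -(fineK ft) lte_fin => rt.
apply/nbhs_ballP; exists (Num.min k.+1%:R^-1 (fine t - r)) => /=.
  by rewrite lt_min subr_gt0 rt andbT invr_gt0.
move=> nu /ball_prohorov[e /andP[e0]]; rewrite lt_min => /andP[ek et] /(_ _ mI).
rewrite -/t => le_t; have mA := measurable_open oA.
have : (t <= nu A + e%:E)%E.
  apply: (le_trans le_t); apply: leeD => //; apply: le_measure; rewrite ?inE//.
    by apply: measurable_open; exact: open_nbhd_of.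
  move=> x [y Ay yx]; apply: (@nbhd_inner_part _ k.+1%:R^-1); exists y => //.
  exact: le_ball (ltW ek) _ yx.
rewrite /= -(fineK ft) -(fineK (fin_num_measure nu _ mA)) -EFinD lee_fin lte_fin.
lra.
Qed.

(** Evaluation at any Borel set is a Borel function of the measure. *)
Lemma measurable_evaluation (A : set (borel X)) : measurable A ->
  measurable_fun [set: borel (pmeas R X)] (fun theta : pmeas R X => theta A).
Proof.
move=> mA.
apply: (@dynkin_induction _ (borel X) (@open X)
  (fun A => measurable_fun [set: borel (pmeas R X)]
     (fun theta : pmeas R X => theta A))) => //.
- by move=> B C; exact: openI.
- rewrite (_ : (fun _ => _) = cst 1%E)//.
  by apply/funext => theta; rewrite probability_setT.
- move=> B oB.
  apply: (measurability _ (ErealGenOInfty.measurableE R)) => //.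
  move=> _ [_ [r ->] <-]; rewrite setTI; apply: sub_sigma_algebra.
  rewrite (_ : _ @^-1` _ = [set theta : pmeas R X | (r%:E < theta B)%E]).
    exact: open_evaluation_gt.
  by apply/seteqP; split => theta /=; rewrite in_itv/= ?andbT.
- move=> B mB mfB.
  rewrite (_ : (fun _ => _) = fun theta : pmeas R X => (1 - theta B)%E).
    by apply: emeasurable_funB => //; exact: measurable_cst.
  by apply/funext => theta; rewrite probability_setC.
move=> F mF tF mfF.
rewrite (_ : (fun _ => _) = fun theta : pmeas R X => (\sum_(k <oo) theta (F k))%E).
  exact: ge0_emeasurable_sum.
apply/funext => theta; apply/esym/cvg_lim => //.
by apply: measure_semi_sigma_additive => //; exact: bigcup_measurable.
Qed.

End measures.

(** * Barycenters *)

Section barycenter.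
Context {R : realType} {X : pmetricType R}.
Context (mut : probability (borel (pmeas R X)) R).

(** The average of the measures [theta] with respect to [mut]. *)
Definition barycenter (A : set (borel X)) : \bar R :=
  (\int[mut]_theta (theta : pmeas R X) A)%E.

Let barycenter0 : barycenter set0 = 0%E.
Proof. by apply: integral0_eq => theta _; rewrite measure0. Qed.

Let barycenter_ge0 A : (0 <= barycenter A)%E.
Proof. exact: integral_ge0. Qed.

Let barycenter_sigma_additive : semi_sigma_additive barycenter.
Proof.
move=> F mF tF mUF; rewrite /barycenter.
rewrite (eq_integral (fun theta : borel (pmeas R X) =>
  (\sum_(k <oo) (theta : pmeas R X) (F k))%E)); last first.
  by move=> theta _; apply/esym/cvg_lim => //; exact: measure_semi_sigma_additive.
rewrite integral_nneseries//; last by move=> k; exact: measurable_evaluation.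
by apply: is_cvg_ereal_nneg_natsum => k _; exact: integral_ge0.
Qed.

HB.instance Definition _ := isMeasure.Build _ _ _ barycenter
  barycenter0 barycenter_ge0 barycenter_sigma_additive.

Lemma continuous_measurable_real (f : X -> R) : continuous f ->
  measurable_fun [set: borel X] (f : borel X -> R).
Proof.
move=> /continuousP cf; apply: (measurability _ (RGenOpens.measurableE R)).
move=> _ [_ [a [b ->] <-]]; rewrite setTI; apply: measurable_open.
exact/cf/interval_open.
Qed.

Lemma measurable_integral (f : X -> R) : continuous f -> (forall x, 0 <= f x) ->
  measurable_fun [set: borel (pmeas R X)]
    (fun theta : pmeas R X => \int[theta]_x (f x)%:E)%E.
Proof.
move=> cf f0.
apply: (@measurable_fun_integral_kernel _ _ (borel (pmeas R X)) (borel X) R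
  (fun theta : borel (pmeas R X) => (theta : pmeas R X) : {measure set _ -> \bar R})).
- exact: measurable_evaluation.
- by move=> x; rewrite lee_fin.
- by apply/measurable_EFinP; exact: continuous_measurable_real.
Qed.

(** The barycenter equation for continuous functions extends to Borel sets. *)
Lemma barycenterE (mu : probability (borel X) R) : compact [set: X] ->
  (forall f : X -> R, continuous f ->
    (\int[mu]_x (f x)%:E = \int[mut]_theta \int[theta : pmeas R X]_x (f x)%:E)%E) ->
  forall A : set (borel X), measurable A -> mu A = barycenter A.
Proof.
move=> cX muE.
have normalX : normal_space X.
  apply: compact_normal; [exact: metric_hausdorff|exact: cX].
(* Continuous functions squeezed between the indicators of an inner part of
   [A] and of [A] itself. *)
have sep (A : set X) k : open A -> exists f : X -> R, [/\ continuous f,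
    forall x, 0 <= f x, forall x, f x <= \1_A x &
    forall x, \1_(inner_part A k.+1%:R^-1) x <= f x].
  move=> oA.
  have [|f [cf f0 f1 f01]] := @urysohn_ext_itv _ R normalX (~` A)
    (inner_part A k.+1%:R^-1) 0 1 (open_closedC oA) (@closed_inner_part _ _ A _) _ ltr01.
    by apply/seteqP; split => // x [nAx Ix]; apply: nAx; exact: (inner_part_sub _ Ix).
  have f_ge0 x : 0 <= f x.
    by have := f01 (f x); rewrite /= in_itv/= => /(_ _)/andP[]//; exists x.
  exists f; split => // x.
    rewrite indicE; have [xA|xA] := boolP (x \in A).
      by have := f01 (f x); rewrite /= in_itv/= => /(_ _)/andP[]//; exists x.
    by rewrite (f0 (f x))//; exists x => //; rewrite notin_setE in xA.
  rewrite indicE; have [xA|//] := boolP (x \in _).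
  by rewrite (f1 (f x))//; exists x => //; rewrite inE in xA.
have ind_le (P : probability (borel X) R) (A : set (borel X)) (f : X -> R) :
    measurable A -> continuous f -> (forall x, \1_A x <= f x) -> (P A <= \int[P]_x (f x)%:E)%E.
  move=> mA cf Af; rewrite -[A in leLHS]setIT -integral_indic//.
  apply: ge0_le_integral => //.
  - by apply/measurable_EFinP; exact: measurable_indic.
  - by apply/measurable_EFinP; exact: continuous_measurable_real.
  - by move=> x _; rewrite lee_fin.
have le_ind (P : probability (borel X) R) (A : set (borel X)) (f : X -> R) :
    measurable A -> continuous f -> (forall x, 0 <= f x) ->
    (forall x, f x <= \1_A x) -> (\int[P]_x (f x)%:E <= P A)%E.
  move=> mA cf f0 fA; rewrite -[A in leRHS]setIT -integral_indic//.
  apply: ge0_le_integral => //.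
  - by move=> x _; rewrite lee_fin.
  - by apply/measurable_EFinP; exact: continuous_measurable_real.
  - by apply/measurable_EFinP; exact: measurable_indic.
  - by move=> x _; rewrite lee_fin.
have open_case A : open A -> mu A = barycenter A.
  move=> oA; have mA := measurable_open oA.
  have mI k := measurable_inner_part A k.+1%:R^-1.
  apply/eqP; rewrite eq_le; apply/andP; split.
    rewrite -(cvg_lim _ (cvg_inner_part (P := mu) oA))//; apply: lime_le.
      by apply/cvg_ex; exists (mu A); exact: cvg_inner_part.
    apply: nearW => k; have [f [cf f0 fA If]] := sep A k oA.
    apply: (le_trans (ind_le mu _ f (mI k) cf If)); rewrite muE//.
    apply: ge0_le_integral => //.
    - by move=> theta _; apply: integral_ge0 => x _; rewrite lee_fin.
    - exact: measurable_integral.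
    - exact: measurable_evaluation.
    - by move=> theta _; exact: le_ind.
  rewrite -(cvg_lim _ (cvg_inner_part (P := barycenter) oA))//; apply: lime_le.
    by apply/cvg_ex; exists (barycenter A); exact: cvg_inner_part.
  apply: nearW => k; have [f [cf f0 fA If]] := sep A k oA.
  apply: le_trans (le_ind mu _ f mA cf f0 fA); rewrite muE//.
  apply: ge0_le_integral => //.
  - exact: measurable_evaluation.
  - exact: measurable_integral.
  - by move=> theta _; exact: ind_le.
move=> A mA; apply: (@measure_unique _ R (borel X) (@open X) (fun=> setT)) => //.
- by move=> B C; exact: openI.
- by move=> _; exact: openT.
- by rewrite bigcup_const//; exists 0%N.
- by move=> _; rewrite [X in (X < _)%E](probability_setT mu) ltry.
Qed.

End barycenter.

(** * Quasifactors *)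

Section induced_iterates.
Context {R : realType} {X : pmetricType R} (T : homeo X X).

Lemma measurable_homeo_preimage (A : set (borel X)) :
  measurable A -> measurable (T @^-1` A : set (borel X)).
Proof.
move=> mA; rewrite -[X in measurable X]setTI.
by apply: (continuous_borel (@homeo_continuous _ _ T)).
Qed.

Lemma measurable_homeo_iter k (A : set (borel X)) :
  measurable A -> measurable (iter k T @^-1` A : set (borel X)).
Proof.
move=> mA; elim: k => [//|k ih].
rewrite (_ : _ @^-1` _ = T @^-1` (iter k T @^-1` A)).
  exact: measurable_homeo_preimage.
by apply/seteqP; split => y /=; rewrite -iterSr.
Qed.

Lemma iter_induced_mapE k (theta : pmeas R X) (A : set (borel X)) :
  measurable A -> iter k (induced_map T) theta A = theta (iter k T @^-1` A).
Proof.
elim: k A => [//|k ih] A mA; rewrite iterS induced_mapE// ih//.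
exact: measurable_homeo_preimage.
Qed.

Lemma measurable_real_evaluation (A : set (borel X)) : measurable A ->
  measurable_fun [set: borel (pmeas R X)] (fun theta : pmeas R X => fine (theta A)).
Proof. by move=> mA; apply: measurableT_comp => //; exact: measurable_evaluation. Qed.

End induced_iterates.

Section quasifactor_entropy.
Context {R : realType} {X : pmetricType R} (T : homeo X X).
Context (mu : probability (borel X) R) (mut : probability (borel (pmeas R X)) R).
Hypothesis compactX : compact [set: X].
Hypothesis mut_quasifactor : quasifactor T mu mut.
Context (F : set (borel X)) (c : R).
Hypothesis mF : measurable F.

(* The measures that give mass more than [c] to [F], and those for which this
   mass is hard to distinguish from [c]. *)
Let heavy := [set theta : pmeas R X | c < fine (theta F)].
Let band eta := [set theta : pmeas R X | c < fine (theta F) <= c + eta].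

(** The iterates of the induced map act on [theta F] through evaluations at
    other Borel sets, so no measurability of the induced map is needed. *)
Lemma measurable_value_set (B : set R) k : measurable B -> measurable
  (iter k (induced_map T) @^-1` [set theta : pmeas R X | B (fine (theta F))]
   : set (borel (pmeas R X))).
Proof.
move=> mB.
rewrite (_ : _ @^-1` _ =
  (fun theta : pmeas R X => fine (theta (iter k T @^-1` F))) @^-1` B).
  rewrite -[X in measurable X]setTI.
  by apply: measurable_real_evaluation => //; exact: measurable_homeo_iter.
by apply/seteqP; split => theta /=; rewrite iter_induced_mapE.
Qed.

Lemma measurable_heavy k :
  measurable (iter k (induced_map T) @^-1` heavy : set (borel (pmeas R X))).
Proof.
have := @measurable_value_set `]c, +oo[ k; rewrite /heavy.
rewrite (_ : [set theta | _] = [set theta : pmeas R X | c < fine (theta F)]).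
  by apply.
by apply/seteqP; split => theta /=; rewrite in_itv/= andbT.
Qed.

Lemma measurable_band eta k :
  measurable (iter k (induced_map T) @^-1` band eta : set (borel (pmeas R X))).
Proof.
have := @measurable_value_set `]c, c + eta] k; rewrite /band.
rewrite (_ : [set theta | _] =
  [set theta : pmeas R X | c < fine (theta F) <= c + eta]); first by apply.
by apply/seteqP; split => theta /=; rewrite in_itv.
Qed.

Lemma band_vanishes e : 0 < e ->
  exists2 eta, 0 < eta & fine (mut (band eta)) <= e.
Proof.
move=> e0; pose D k : set (borel (pmeas R X)) := band k.+1%:R^-1.
have mD k : measurable (D k) := measurable_band k.+1%:R^-1 0.
have D0 : \bigcap_k D k = set0.
  apply/seteqP; split => // theta h.
  have := h 0%N I; rewrite /D /band/= => /andP[cF _].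
  have d0 : 0 < fine (theta F) - c by rewrite subr_gt0.
  have [k _ /(_ k (leqnn k))] := near_infty_natSinv_lt (PosNum d0).
  by rewrite /= ltrBrDl ltNge; have := h k I; rewrite /D /band/= => /andP[_ ->].
have cD : mut (D k) @[k --> \oo] --> 0%E.
  rewrite -(measure0 mut) -D0; apply: (nonincreasing_cvg_mu (mu := mut)) => //.
  - by rewrite (le_lt_trans (probability_le1 _ (mD 0%N)))// ltry.
  - by rewrite D0.
  - move=> i j ij; apply/subsetPset => theta; rewrite /D /band/= => /andP[-> h] /=.
    by apply: (le_trans h); rewrite lerD2l lef_pV2 ?posrE// ler_nat ltnS.
have [k ke] : exists k, (mut (D k) < e%:E)%E.
  apply: contrapT => /forallNP h.
  have : (e%:E <= 0)%E.
    rewrite -(cvg_lim _ cD)//; apply: lime_ge; first by apply/cvg_ex; exists 0%E.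
    by apply: nearW => k; rewrite leNgt; exact/negP.
  by rewrite lee_fin leNgt e0.
exists k.+1%:R^-1; first by rewrite invr_gt0.
by rewrite -lee_fin fineK ?ltW//; exact: (fin_num_measure mut _ (mD k)).
Qed.

Lemma quasifactor_word_entropy_le (eta e : R) m n : (0 < m)%N -> 0 < eta ->
  0 < e < 1 -> (m%:R * eta ^+ 2)^-1 + fine (mut (band eta)) <= e ->
  word_entropy mut (induced_map T) heavy n <=
  m%:R * word_entropy mu T F n + n%:R * (- ln (1 - e) - e * ln e).
Proof.
move=> m0 eta0 e01 le_e.
have mit (w : {ffun 'I_n -> bool}) :
    measurable (itinerary (Y := borel X) T F n @^-1` [set w] : set (borel X)).
  by apply: measurable_itinerary => k; exact: measurable_homeo_iter.
pose g (u : {ffun 'I_n -> bool}) (theta : borel (pmeas R X)) : R :=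
  fine ((theta : pmeas R X) (itinerary (Y := borel X) T F n @^-1` [set u])).
have qE : (fun u => (\int[mut]_theta g u theta)%R) =
    (fun u => fine (mu (itinerary (Y := borel X) T F n @^-1` [set u]))).
  apply/funext => u; rewrite (barycenterE compactX mut_quasifactor.2)//.
  congr fine; apply: eq_integral => theta _; rewrite /g fineK//.
  by apply: fin_num_measure.
have fE (i : 'I_n) theta : \sum_(u : {ffun 'I_n -> bool} | u i) g u theta =
    fine ((theta : pmeas R X) (iter i T @^-1` F)).
  rewrite (sum_fiber_measure (theta : pmeas R X) (fun u : {ffun 'I_n -> bool} => u i) mit).
  by congr (fine (_ _)); apply/seteqP; split => x /=; rewrite ffunE => /asboolP.
rewrite /word_entropy -qE.
apply: (@entropy_threshold_le _ _ (borel (pmeas R X)) mut n m g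
  (itinerary (Y := borel (pmeas R X)) (induced_map T) heavy n)
  c eta (fine (mut (band eta))) e) => //.
- by move=> u; exact: measurable_real_evaluation.
- by move=> u theta; exact: fine_ge0.
- move=> theta; rewrite (sum_fiber_measure (theta : pmeas R X) xpredT mit).
  transitivity (fine ((theta : pmeas R X) setT)); last by rewrite probability_setT.
  by congr (fine (_ _)); apply/seteqP.
- by move=> w; apply: measurable_itinerary => k; exact: measurable_heavy.
- move=> theta i; rewrite ffunE fE /heavy/= iter_induced_mapE//.
  by apply/asboolP/idP.
- move=> i; rewrite le_eqVlt; apply/orP; left; apply/eqP; congr fine.
  rewrite -(@invariant_iter _ _ _ mut (induced_map T) i (band eta))//.
  + congr (mut _); apply/seteqP; split => theta;
      by rewrite /band/= fE iter_induced_mapE.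
  + exact: mut_quasifactor.1.
  + by move=> k; exact: measurable_band.
Qed.

(** Positive entropy of the set of measures giving mass more than [c] to [F]
    forces positive entropy of [F]. *)
Lemma quasifactor_entropy_gt0 : invariant_measure mu T ->
  0 < ks_entropy mut (induced_map T) (bipartition heavy) ->
  0 < ks_entropy mu T (bipartition F).
Proof.
move=> inv_mu; rewrite !ks_entropy_word; set h := limn _ => h0.
have ln2 : 0 < ln 2 :> R by apply: ln_gt0; rewrite ltr1n.
(* A divergent sequence would have [limn] equal to 0. *)
have cvg_mut : cvgn (fun n =>
    n%:R^-1 * word_entropy mut (induced_map T) heavy n / ln 2).
  by apply: contrapT => /dvgP; rewrite -/h => h_eq; rewrite h_eq ltxx in h0.
have cvg_mu : cvgn (fun n => n%:R^-1 * word_entropy mu T F n / ln 2).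
  apply: is_cvgM; last exact: is_cvg_cst.
  apply: subadditive_cvg => [n|n k].
    by apply: word_entropy_ge0 => k; exact: measurable_homeo_iter.
  apply: word_entropy_subadditive => //.
    by move=> l; exact: measurable_homeo_iter.
  exact: measurable_homeo_preimage.
have [e e01 cost_h] := small_bit_cost (mulr_gt0 h0 ln2).
have [e0 e1] := andP e01.
have [eta eta0 band_e] := band_vanishes (divr_gt0 e0 (ltr0Sn _ 1)).
have eta2 : 0 < eta ^+ 2 by rewrite exprn_gt0.
pose m := (Num.bound ((e / 2 * eta ^+ 2)^-1)).+1.
have m_large : (m%:R * eta ^+ 2)^-1 <= e / 2.
  have em : (e / 2 * eta ^+ 2)^-1 <= m%:R.
    apply/ltW/(lt_le_trans (archi_boundP _)); last by rewrite ler_nat.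
    by rewrite invr_ge0 mulr_ge0 ?divr_ge0 ?ltW.
  rewrite invf_ple ?posrE ?mulr_gt0 ?divr_gt0 ?ltr0n//.
  by move: em; rewrite invfM ler_pdivrMr.
set K := - ln (1 - e) - e * ln e in cost_h *.
have le_n n : (0 < n)%N ->
    n%:R^-1 * word_entropy mut (induced_map T) heavy n / ln 2 <=
    m%:R * (n%:R^-1 * word_entropy mu T F n / ln 2) + K / ln 2.
  move=> n0; have nR : 0 < n%:R :> R by rewrite ltr0n.
  have -> : m%:R * (n%:R^-1 * word_entropy mu T F n / ln 2) + K / ln 2 =
      n%:R^-1 * (m%:R * word_entropy mu T F n + n%:R * K) / ln 2.
    by field; rewrite !gt_eqF.
  rewrite ler_wpM2r ?invr_ge0 ?(ltW ln2)// ler_wpM2l ?invr_ge0 ?(ltW nR)//.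
  by apply: (quasifactor_word_entropy_le (eta := eta)) => //; rewrite [leRHS]splitr lerD.
set l := limn _.
have le_h : h <= m%:R * l + K / ln 2.
  have cvg_bound : (fun n => m%:R * (n%:R^-1 * word_entropy mu T F n / ln 2) +
      K / ln 2) @ \oo --> m%:R * l + K / ln 2.
    by apply: cvgD; [apply: cvgM; [exact: cvg_cst|exact: cvg_mu]|exact: cvg_cst].
  rewrite -(cvg_lim _ cvg_bound)//; apply: ler_lim => //.
    by apply/cvg_ex; exists (m%:R * l + K / ln 2).
  by near=> n; apply: le_n; near: n; exact: nbhs_infty_gt.
have Kh : K / ln 2 < h by rewrite ltr_pdivrMr.
have m0 : 0 < m%:R :> R by rewrite ltr0n.
rewrite -(pmulr_rgt0 _ m0); lra.
Unshelve. all: by end_near. Qed.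

End quasifactor_entropy.

Section dirac_measures.
Context {R : realType} {X : pmetricType R}.

(** The point mass at [x], as a point of the space of measures. *)
Definition point_mass (x : X) : pmeas R X :=
  mk_pmeas (\d_(x : borel X) : probability (borel X) R).

Lemma point_massE (x : X) (A : set (borel X)) : measurable A ->
  point_mass x A = (\1_A x)%:E.
Proof. by move=> mA; rewrite mk_pmeasE// diracE indicE. Qed.

Lemma nbhs_point_mass (x : X) (A : set (borel X)) (r : R) : measurable A ->
  nbhs x (A : set X) -> r < 1 ->
  nbhs (point_mass x) [set theta : pmeas R X | r < fine (theta A)].
Proof.
move=> mA xA r1.
have oI : open (interior (A : set X)) by exact: open_interior.
have mI : measurable (interior (A : set X) : set (borel X)) by exact: measurable_open.
have : nbhs (point_mass x) [set theta : pmeas R X |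
    (r%:E < theta (interior (A : set X) : set (borel X)))%E].
  apply: open_nbhs_nbhs; split; first exact: open_evaluation_gt.
  by rewrite /= point_massE// indicE mem_set// lte_fin.
apply: filterS => theta /= rI; rewrite -lte_fin fineK; last exact: fin_num_measure.
apply: (lt_le_trans rI); apply: le_measure; rewrite ?inE//.
exact: interior_subset.
Qed.

End dirac_measures.

(** * Uniformly positive entropy passes from a quasifactor to the system *)

Theorem theorem6 (R : realType) (X : pmetricType R) (T : homeo X X)
    (mu : probability (borel X) R) (mut : probability (borel (pmeas R X)) R)
    (compactX : compact [set: X])
    (mu_invariant : invariant_measure mu T) (mu_ergodic : ergodic mu T)
    (mut_quasifactor : quasifactor T mu mut) :
  UPE mut (induced_map T) -> UPE mu T.
Proof.
move=> upe y y' yy'; split=> // F mF yF y'F.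
have mFC : measurable (~` F) by exact: measurableC.
have masses_neq : point_mass y <> point_mass y'.
  move=> /(congr1 (fun theta : pmeas R X => theta F)).
  rewrite !point_massE// !indicE mem_set; last exact: nbhs_singleton yF.
  rewrite memNset; last exact: nbhs_singleton y'F.
  by move=> /eqP; rewrite eqe oner_eq0.
have half1 : 1 / 2 < 1 :> R by lra.
apply: (quasifactor_entropy_gt0 compactX mut_quasifactor (c := 1 / 2) mF mu_invariant).
apply: (upe _ _ masses_neq).2; first exact: (measurable_heavy T (1 / 2) mF 0).
  exact: nbhs_point_mass.
apply: filterS (nbhs_point_mass mFC y'F half1) => theta /=.
rewrite probability_setC// fineB ?fin_num_measure//= => h1 h2.
move: h1 h2; lra.
Qed.
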